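(* Let $q=q(n)\ge 2$ be a sequence of integers with $q = o(\sqrt{\log n})$ as $n\to\infty$, and let $\mathcal{H}_n$ be the (random) $q$-uniform hypergraph on $[n]$ obtained when the $q$-linear process on $[n]$ terminates. Then with high probability $$|E(\mathcal{H}_n)| \geq \frac{n(n-1)}{q(q-1)}(1 - o(1)),$$ that is, there is a deterministic sequence $\delta_n\to 0$ such that $\mathbb{P}\left(|E(\mathcal{H}_n)|\ge (1-\delta_n)\frac{n(n-1)}{q(q-1)}\right)\to 1$ as $n\to\infty$.
   Context: $[n]=\{1,\dots,n\}$ and $\binom{[n]}{q}$ is the set of $q$-element subsets of $[n]$. The $q$-linear process on $[n]$: start with the empty $q$-uniform hypergraph on $[n]$. In step $i\ge 1$, given the previously chosen edges $e_1,\dots,e_{i-1}$, pick $e_i$ uniformly at random from the set $\left\{e\in\binom{[n]}{q}: |e\cap e_j|\le 1 \text{ for } 1\le j\le i-1\right\}$ and add it to the hypergraph. The process terminates when this set is empty, and the output is the hypergraph whose edges are all the chosen $e_i$. *)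

(* Defs.v *)
From HB Require Import structures.
From mathcomp Require Import all_boot all_order all_algebra.

Set Implicit Arguments.
Unset Strict Implicit.
Unset Printing Implicit Defensive.

Import Order.TTheory GRing.Theory Num.Theory.
Local Open Scope ring_scope.

(* A hypergraph on the vertex set 'I_n (standing for [n]) is identified with *)
(* its edge set H : {set {set 'I_n}}.                                        *)

Definition available (n q : nat) (H : {set {set 'I_n}}) : {set {set 'I_n}} :=
  [set e : {set 'I_n} | (#|e| == q) && [forall f in H, (#|e :&: f| <= 1)%N]].

(* Transition probability from H to H' in one step. A terminated process    *)
(* stays where it is, so that its output can be read off at any later time. *)
Definition linear_step (R : realFieldType) (n q : nat)
    (H H' : {set {set 'I_n}}) : R :=
  if available q H == set0 then (H' == H)%:R
  else \sum_(e in available q H) (H' == e |: H)%:R / #|available q H|%:R.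

Fixpoint linear_law (R : realFieldType) (n q t : nat)
    (H : {set {set 'I_n}}) : R :=
  if t is t'.+1 then
    \sum_(G : {set {set 'I_n}}) linear_law R q t' G * linear_step R q G H
  else (H == set0)%:R.

(* For q >= 2 each step before termination adds a new q-set (a q-set meets  *)
(* itself in more than one vertex), so the process has terminated after     *)
(* 'C(n, q) steps: see output_law_terminated.                               *)
Definition output_law (R : realFieldType) (n q : nat)
    (H : {set {set 'I_n}}) : R :=
  linear_law R q 'C(n, q) H.

Definition output_prob (R : realFieldType) (n q : nat)
    (A : pred {set {set 'I_n}}) : R :=
  \sum_(H | A H) output_law R q H.

Lemma linear_step_ge0 (R : realFieldType) n q (G H : {set {set 'I_n}}) :
  0 <= linear_step R q G H.
Proof.
rewrite /linear_step; case: ifP => _; first exact: ler0n.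
by apply: sumr_ge0 => e _; rewrite divr_ge0 ?ler0n.
Qed.

Lemma linear_step_sum1 (R : realFieldType) n q (G : {set {set 'I_n}}) :
  \sum_H linear_step R q G H = 1.
Proof.
have delta1 (K : {set {set 'I_n}}) : \sum_H (H == K)%:R = 1 :> R.
  rewrite (bigD1 K) //= eqxx big1 ?addr0 // => H HK.
  by rewrite (negbTE HK).
rewrite /linear_step; case: eqP => [_|/eqP]; first exact: delta1.
rewrite -card_gt0 => c0; rewrite exchange_big /=.
under eq_bigr => e _ do rewrite -mulr_suml delta1 mul1r.
by rewrite sumr_const -[_ *+ _]mulr_natr mulVf // pnatr_eq0 -lt0n.
Qed.

Lemma linear_law_ge0 (R : realFieldType) n q t (H : {set {set 'I_n}}) :
  0 <= linear_law R q t H.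
Proof.
elim: t H => [|t IH] H /=; first exact: ler0n.
by apply: sumr_ge0 => G _; rewrite mulr_ge0 ?IH ?linear_step_ge0.
Qed.

Lemma linear_law_sum1 (R : realFieldType) n q t :
  \sum_(H : {set {set 'I_n}}) linear_law R q t H = 1.
Proof.
elim: t => [|t IH] /=.
  rewrite (bigD1 set0) //= eqxx big1 ?addr0 // => H HK.
  by rewrite (negbTE HK).
rewrite exchange_big /= -[RHS]IH; apply: eq_bigr => G _.
by rewrite -mulr_sumr linear_step_sum1 mulr1.
Qed.

Lemma linear_law_supp (R : realFieldType) n q t (H : {set {set 'I_n}}) :
  (1 < q)%N -> linear_law R q t H != 0 ->
  H \subset [set e : {set 'I_n} | #|e| == q] /\
  (available q H == set0) || (#|H| == t).
Proof.
move=> q1; elim: t H => [|t IH] H /=.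
  have [->|_] := eqVneq H set0; last by rewrite eqxx.
  by rewrite cards0 eqxx orbT sub0set.
move=> nz.
have [G] : exists G, linear_law R q t G * linear_step R q G H != 0.
  apply/existsP; apply: contraNT nz => /existsPn all0.
  by rewrite big1 // => G _; apply/eqP/negbNE/all0.
rewrite mulf_eq0 negb_or => /andP[/IH[Gq GT]].
rewrite /linear_step; case: ifP GT => [T _|NT /= /eqP <-].
  by have [->|_] := eqVneq H G; rewrite ?eqxx // T.
case: (boolP [exists e in available q G, H == e |: G]); last first.
  move=> /exists_inPn no; rewrite big1 ?eqxx // => e /no /negbTE->.
  by rewrite mul0r.
move=> /exists_inP[e]; rewrite inE => /andP[eq /forall_inP lin] /eqP-> _.
split; first by rewrite subUset Gq sub1set inE eq.
rewrite cardsU1; suff -> : e \notin G by rewrite eqxx orbT.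
by apply/negP => /lin; rewrite setIid (eqP eq) leqNgt q1.
Qed.

Lemma output_law_terminated (R : realFieldType) n q (H : {set {set 'I_n}}) :
  (1 < q)%N -> output_law R q H != 0 -> available q H = set0.
Proof.
move=> q1 /(linear_law_supp q1)[Hq /orP[/eqP//|/eqP cH]].
have EH : H = [set e : {set 'I_n} | #|e| == q].
  by apply/eqP; rewrite eqEcard Hq card_draws card_ord cH leqnn.
apply/setP => e; rewrite !inE; apply/negP => /andP[eq /forall_inP lin].
have /lin : e \in H by rewrite EH inE.
by rewrite setIid (eqP eq) leqNgt q1.
Qed.

(* Main.v *)
(* The available edges form a k-uniform hypergraph on the uncovered pairs (the
   pairs of vertices contained in no chosen edge), with
   k = q(q-1)/2, and the process picks one of its edges at random and deletes
   everything meeting it.  It starts D-regular with D = C(n-2, q-2) and keeps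
   codegrees at most D(q-2)/(n-2).  Let X_v be the degree of an uncovered pair
   v.  If every X_v is x(1 +- eta), then in one step E[X_v] drops by the
   relative amount mu (1 +- 3 eta), with mu = k(k-1)/#(uncovered pairs), so with
   x replaced by x(1 - mu) the error eta only has to grow by a factor 1 + 16 mu.
   As X_v is monotone and drops by at most k times the codegree, the sum over v
   of exp(lam (X_v/x - 1 - eta)) + exp(lam (1 - X_v/x - eta)) is a
   supermartingale as long as it is below 1, and below 1 it certifies
   X_v = x(1 +- eta) for all v.  Up to the time when a fraction eps of the pairs
   is left, the total growth and decay factors are exp(O(k/eps)); for
   eps = q / sqrt(log n) this is n^o(1), which the codegree ratio, of order 1/n,
   absorbs. *)
Require Import Defs.
From mathcomp Require Import all_boot all_order all_algebra.
From mathcomp Require Import reals sequences exp zify ring lra.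
Import Order.TTheory GRing.Theory Num.Theory.

Set Implicit Arguments.
Unset Strict Implicit.
Unset Printing Implicit Defensive.

(** * Counting in uniform hypergraphs *)

Section HypergraphCounting.

Variables (V T : finType) (sh : T -> {set V}).
Implicit Types (A : {set T}) (K : T) (v w : V).

(** Edges are elements of [T] with vertex set [sh e]. In the application [e] is a [q]-set and its
    vertices are the pairs inside it, so [#|star A v|] is the degree of the pair [v]. *)
Definition star A v : {set T} := [set e in A | v \in sh e].

Definition hit A K : {set T} := [set e in A | ~~ [disjoint sh e & sh K]].

(** Divided by [#|A|], this is the expected drop in the degree of [v], restricted to the choices [K]
    that do not cover [v]. *)
Definition lost A v : nat :=
  \sum_(K in A | v \notin sh K) #|star A v :&: hit A K|.

Lemma card_setE (U : finType) (B : {set U}) (P : pred U) :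
  #|[set x in B | P x]| = \sum_(x in B) P x.
Proof. by rewrite -sum1dep_card big_mkcondr. Qed.

Lemma sum_card_star A (B : {set V}) :
  \sum_(w in B) #|star A w| = \sum_(e in A) #|B :&: sh e|.
Proof.
under eq_bigr do rewrite card_setE.
rewrite exchange_big; apply: eq_bigr => e _ /=.
by rewrite -card_setE; apply: eq_card => w; rewrite !inE.
Qed.

Lemma card_star_diff A v K :
  #|star [set e in A | [disjoint sh e & sh K]] v| + #|star A v :&: hit A K|
    = #|star A v|.
Proof.
rewrite addnC -(cardsID (hit A K) (star A v)); congr (_ + #|pred_of_set _|).
by apply/setP => e; rewrite !inE; do !case: (_ \in _) => //=; case: [disjoint _ & _].
Qed.

(** Double counting of the pairs of meeting edges of which the first contains [v] and the second
    does not. *)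
Lemma lostE A v :
  lost A v = \sum_(e in star A v) #|[set K in hit A e | v \notin sh K]|.
Proof.
rewrite /lost; under eq_bigr => K _.
  have -> : star A v :&: hit A K
          = [set e in star A v | ~~ [disjoint sh e & sh K]].
    by apply/setP => e; rewrite !inE; case: (e \in A).
  rewrite card_setE; over.
rewrite exchange_big; apply: eq_bigr => e _ /=.
rewrite -sum1dep_card big_mkcond [RHS]big_mkcond; apply: eq_bigr => K _ /=.
rewrite !inE disjoint_sym.
by case: (K \in A); case: [disjoint _ & _]; case: (v \in sh K).
Qed.

(** Union bound: an edge through [v] that meets [K] contains one of the [k] vertices of [K], all
    different from [v], and the codegree bounds the edges for each. *)
Lemma card_star_hit_le A (k c : nat) v K :
  #|sh K| = k -> v \notin sh K ->
  (forall w, v != w -> #|star A v :&: star A w| <= c) ->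
  #|star A v :&: hit A K| <= k * c.
Proof.
move=> <- vK codeg.
apply: (@leq_trans #|\bigcup_(w in sh K) (star A v :&: star A w)|).
  apply/subset_leq_card/subsetP => e; rewrite !inE => /andP[/andP[eA ve]].
  rewrite eA /= => /pred0Pn[w /= /andP[we wK]].
  by apply/bigcupP; exists w; rewrite // !inE eA ve we.
apply: (@leq_trans (\sum_(w in sh K) #|star A v :&: star A w|)).
  elim/big_rec2: _ => [|w m B _ le]; first by rewrite cards0.
  by rewrite (leq_trans (leq_card_setU _ _).1) ?leq_add2l.
rewrite -sum_nat_const; apply: leq_sum => w wK; apply: codeg.
by apply: contraNneq vK => ->.
Qed.

Lemma card_hit_le A v e :
  #|[set K in hit A e | v \notin sh K]| <= \sum_(w in sh e :\ v) #|star A w|.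
Proof.
rewrite sum_card_star -sum1dep_card big_mkcond [leqRHS]big_mkcond /=.
apply: leq_sum => K _; rewrite !inE.
case: (K \in A) => //=; case: ifP => // /andP[/pred0Pn[w /= /andP[wK we]] vK].
rewrite card_gt0; apply/set0Pn; exists w; rewrite !inE wK we !andbT.
by apply: contraNneq vK => <-.
Qed.

(* Bonferroni: subtracting the pairs of common vertices leaves at most 1 for
   each K that meets e but avoids v, and at most 0 for each other K. *)
Lemma card_hit_ge A v e : v \in sh e ->
  \sum_(w in sh e :\ v) #|star A w|
    <= #|[set K in hit A e | v \notin sh K]|
       + \sum_(w in sh e :\ v) \sum_(w' in sh e :\ w) #|star A w :&: star A w'|.
Proof.
move=> ve.
have codegE w w' : #|star A w :&: star A w'|
    = \sum_(K in A) (w \in sh K) * (w' \in sh K).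
  transitivity #|[set K in A | (w \in sh K) && (w' \in sh K)]|.
    by apply: eq_card => K; rewrite !inE; case: (K \in A).
  by rewrite card_setE; apply: eq_bigr => K _; case: (w \in sh K); case: (w' \in sh K).
under [X in _ <= _ + X]eq_bigr => w _.
  under eq_bigr do rewrite codegE.
  rewrite exchange_big /=.
  under eq_bigr do rewrite -big_distrr /=.
  over.
rewrite exchange_big /=.
have -> : #|[set K in hit A e | v \notin sh K]|
    = \sum_(K in A) (~~ [disjoint sh K & sh e] && (v \notin sh K)).
  by rewrite -card_setE; apply: eq_card => K; rewrite !inE andbA.
rewrite -big_split /=; under eq_bigr do rewrite card_setE.
rewrite exchange_big /=; apply: leq_sum => K KA.
(* For [K] through [v], each common vertex [w] is cancelled by the term [w' = v]. *)
have [vK|vK] := boolP (v \in sh K).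
  rewrite andbF add0n; apply: leq_sum => w; rewrite !inE => /andP[wv we].
  case: (w \in sh K) => //; rewrite mul1n (bigD1 v) ?vK //.
  by rewrite !inE eq_sym wv.
rewrite andbT; have [dis|] := boolP [disjoint sh K & sh e].
  rewrite [leqLHS]big1 // => w; rewrite !inE => /andP[_ we].
  by rewrite (disjointFl dis we).
case/pred0Pn => w0 /= /andP[w0K w0e].
have w0B : w0 \in sh e :\ v.
  by rewrite !inE w0e andbT; apply: contraNneq vK => <-.
(* The vertex [w0] accounts for the 1; every other common [w] is cancelled by the term [w' = w0]. *)
rewrite (bigD1 w0) //= [X in _ <= _ + X](bigD1 w0) //= w0K leq_add2l.
apply: leq_trans (leq_addl _ _); apply: leq_sum => w /andP[wB ww0].
case: (w \in sh K) => //; rewrite mul1n (bigD1 w0) ?w0K //.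
by rewrite !inE eq_sym ww0.
Qed.

End HypergraphCounting.

(** * Pairs covered by edges *)

(** Adding [S] is a bijection from the subsets of size [q - #|S|] of the complement of [S]. *)
Lemma cards_draws_supset (T : finType) (S : {set T}) (q : nat) :
  #|S| <= q ->
  #|[set e : {set T} | (S \subset e) && (#|e| == q)]| = 'C(#|T| - #|S|, q - #|S|).
Proof.
move=> Sq; have <- : #|~: S| = #|T| - #|S| by rewrite cardsCs setCK.
rewrite -cards_draws -[RHS](card_in_imset (f := fun e => S :|: e)); last first.
  have D (g : {set T}) : g \subset ~: S -> (S :|: g) :\: S = g.
    rewrite -disjoints_subset setDUl setDv set0U => gS.
    exact/setDidPl.
  move=> e f; rewrite !inE => /andP[eS _] /andP[fS _] ef.
  by rewrite -(D e eS) ef D.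
apply: eq_card => e; apply/idP/imsetP.
  rewrite inE => /andP[Se /eqP eq]; exists (e :\: S).
    by rewrite !inE subsetDr cardsDS // eq eqxx.
  by rewrite -[in LHS](setID e S) (setIidPr Se).
case=> f; rewrite !inE => /andP[fS /eqP fq] ->.
rewrite subsetUl /= cardsU fq (_ : S :&: f = set0) ?cards0 ?subn0 ?subnKC //.
by apply/eqP; rewrite setI_eq0 disjoint_sym disjoints_subset.
Qed.

Section Shadow.

Variable n : nat.
Implicit Types (e f v w : {set 'I_n}) (H : {set {set 'I_n}}) (q : nat).

Definition shadow e : {set {set 'I_n}} :=
  [set v : {set 'I_n} | (v \subset e) && (#|v| == 2)].

Definition uncovered H : {set {set 'I_n}} :=
  [set v : {set 'I_n} | #|v| == 2] :\: \bigcup_(e in H) shadow e.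

Lemma card_shadow e : #|shadow e| = 'C(#|e|, 2).
Proof. exact: cards_draws. Qed.

(** Turns linearity into disjointness: the process becomes the random greedy choice of pairwise
    disjoint edges in the hypergraph of shadows. *)
Lemma disjoint_shadow e f : [disjoint shadow e & shadow f] = (#|e :&: f| <= 1).
Proof.
apply/idP/idP => [dis|ef1]; last first.
  apply/pred0Pn => -[v /=]; rewrite !inE => /andP[/andP[ve /eqP v2] /andP[vf _]].
  have := subset_leq_card (introT subsetIP (conj ve vf)).
  by rewrite v2 leqNgt ltnS ef1.
rewrite leqNgt; apply/negP => /card_gt1P[a [b [+ + ab]]].
rewrite !inE => /andP[ae af] /andP[be bf].
have sub (g : {set 'I_n}) : a \in g -> b \in g -> [set a; b] \in shadow g.
  by move=> ag bg; rewrite inE cards2 ab andbT subUset !sub1set ag bg.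
by have := disjointFr dis (sub _ ae be); rewrite sub.
Qed.

Lemma in_available q H e : (e \in available q H) =
  (#|e| == q) && [forall f in H, [disjoint shadow e & shadow f]].
Proof.
by rewrite inE; congr (_ && _); apply: eq_forallb_in => f _; rewrite disjoint_shadow.
Qed.

Lemma available0 q : available q (set0 : {set {set 'I_n}}) = [set e : {set 'I_n} | #|e| == q].
Proof.
apply/setP => e; rewrite !inE andb_idr // => _.
by apply/forall_inP => f; rewrite inE.
Qed.

Lemma availableU1 q H e :
  available q (e |: H) = [set f in available q H | [disjoint shadow f & shadow e]].
Proof.
apply/setP => f; rewrite inE !in_available -andbA; congr (_ && _).
apply/forall_inP/andP => [dis|[/forall_inP dis fe] g].
  split; last by rewrite dis ?setU11.
  by apply/forall_inP => g gH; rewrite dis // setU1r.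
by case/setU1P => [->//|]; apply: dis.
Qed.

Lemma available_notin q H e : 1 < q -> e \in available q H -> e \notin H.
Proof.
move=> q1; rewrite inE => /andP[/eqP eq /forall_inP lin].
by apply/negP => /lin; rewrite setIid eq leqNgt q1.
Qed.

Lemma uncovered0 : uncovered set0 = [set v : {set 'I_n} | #|v| == 2].
Proof. by rewrite /uncovered big_set0 setD0. Qed.

Lemma uncoveredU1 H e : uncovered (e |: H) = uncovered H :\: shadow e.
Proof.
have [eH|eH] := boolP (e \in H); last by rewrite /uncovered big_setU1 //= setUC setDDl.
rewrite (setUidPr _) ?sub1set //; apply/esym/setDidPl.
rewrite disjoint_sym disjoints_subset /uncovered setCD.
by apply: subset_trans (subsetUr _ _); rewrite (bigcup_sup e).
Qed.

Lemma shadow_sub_uncovered q H e : e \in available q H -> shadow e \subset uncovered H.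
Proof.
rewrite in_available => /andP[_ /forall_inP dis].
apply/subsetP => v ve; rewrite inE; apply/andP; split.
  by apply/bigcupP => -[f /dis fe vf]; rewrite (disjointFr fe ve) in vf.
by move: ve; rewrite !inE => /andP[].
Qed.

Lemma degree0 q v : 1 < q -> v \in uncovered set0 ->
  #|star shadow (available q set0) v| = 'C(n - 2, q - 2).
Proof.
move=> q1; rewrite uncovered0 inE => /eqP v2.
have := @cards_draws_supset _ v q; rewrite v2 card_ord => <- //.
apply: eq_card => e; rewrite !inE v2 eqxx andbT andbC.
by have /setP/(_ e) := available0 q; rewrite !inE => ->.
Qed.

(** Two distinct pairs span at least three points, so a common edge contains a fixed triple. The
    [q]-sets through it number C(n - 3, q - 3), which absorption rewrites as the stated quotient. *)
Lemma codegree_bound q H v w : 1 < q -> v != w ->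
  #|star shadow (available q H) v :&: star shadow (available q H) w|
    <= 'C(n - 2, q - 2) * (q - 2) %/ (n - 2).
Proof.
move=> q1 vw.
set S := _ :&: _; have [->|[e0 e0S]] := set_0Vmem S; first by rewrite cards0.
have vwS e : e \in S -> [/\ v \subset e, w \subset e, #|v| = 2, #|w| = 2 & #|e| = q].
  by rewrite !inE => /andP[/andP[/andP[/eqP-> _] /andP[-> /eqP->]] /andP[_ /andP[-> /eqP->]]].
have [ve0 we0 v2 w2 e0q] := vwS _ e0S.
have [z zw zv] : exists2 z, z \in w & z \notin v.
  apply/subsetPn; apply: contra vw => wv.
  by rewrite eq_sym eqEcard wv v2 w2.
have zv3 : #|z |: v| = 3 by rewrite cardsU1 zv v2.
have q3 : 2 < q.
  by rewrite -zv3 -e0q subset_leq_card // subUset sub1set (subsetP we0).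
have n3 : 2 < n.
  by rewrite -zv3 -[leqRHS]card_ord max_card.
rewrite leq_divRL ?subn_gt0 //.
have <- : (n - 2) * 'C(n - 3, q - 3) = 'C(n - 2, q - 2) * (q - 2).
  have [-> ->] : n - 3 = (n - 2).-1 /\ q - 2 = (q - 3).+1.
    by rewrite -subnS; split=> //; rewrite -subSn.
  by rewrite mul_bin_diag mulnC.
rewrite mulnC leq_mul2l; apply/orP; right.
have := @cards_draws_supset _ (z |: v) q; rewrite zv3 card_ord => <- //.
apply/subset_leq_card/subsetP => e /vwS[ve we _ _ eq].
by rewrite inE eq eqxx andbT subUset sub1set ve (subsetP we).
Qed.

End Shadow.

Arguments shadow {n} e.

Local Open Scope ring_scope.

(** * One step of the process *)

Section ExponentialMoments.

Variable R : realType.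
Implicit Types lam eta beta y m z mu : R.

(** Follows from [1 + y <= expR y], because (1 + y)(1 - y + y^2) = 1 + y^3 >= 1. *)
Lemma expRN_le_quad y : 0 <= y -> expR (- y) <= 1 - y + y ^+ 2.
Proof.
move=> y0; rewrite expRN -[leRHS]invrK lef_pV2 ?posrE ?invr_gt0 ?expR_gt0 //; last nra.
apply: le_trans (expR_ge1Dx y); rewrite -div1r ler_pdivrMr; last nra.
nra.
Qed.

(** Follows from [1 - y <= expR (- y)], because (1 - y)(1 + y + 3/2 y^2) = 1 + y^2 (1 - 3y)/2, which
    is at least 1 for y <= 1/3. *)
Lemma expR_le_quad y : 0 <= y <= 1 / 3 -> expR y <= 1 + y + 3 / 2 * y ^+ 2.
Proof.
move=> /andP[y0 y3]; rewrite -[y in expR y]opprK expRN.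
rewrite -[leRHS]invrK lef_pV2 ?posrE ?invr_gt0 ?expR_gt0 //; last nra.
apply: le_trans (expR_ge1Dx (- y)); rewrite -div1r ler_pdivrMr; last nra.
nra.
Qed.

(** Here [Q] will be the number of all choices and [S] the choices sparing a given vertex. As
    [lam * y i <= eta], the quadratic term costs only the factor [1 - eta] in the linear one, and
    [1 + a <= expR a] restores an exponential. *)
Lemma sum_expRN_le (I : finType) (S : pred I) (y : I -> R) lam eta beta (Q m : R) :
  0 <= lam -> lam * beta <= eta -> eta <= 1 ->
  (forall i, S i -> 0 <= y i <= beta) ->
  \sum_(i | S i) 1 <= Q -> 0 <= Q -> Q * m <= \sum_(i | S i) y i ->
  \sum_(i | S i) expR (- (lam * y i)) <= Q * expR (- (lam * (1 - eta) * m)).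
Proof.
move=> lam0 lb eta1 yb SQ Q0 Qm.
apply: (@le_trans _ _ (\sum_(i | S i) (1 - lam * (1 - eta) * y i))).
  apply: ler_sum => i /yb/andP[y0 ylb].
  have ly0 : 0 <= lam * y i by apply: mulr_ge0.
  have lyb : lam * y i <= eta by apply: le_trans lb; apply: ler_wpM2l.
  apply: le_trans (expRN_le_quad ly0) _; nra.
rewrite sumrB -mulr_sumr.
apply: (@le_trans _ _ (Q * (1 - lam * (1 - eta) * m))); last first.
  by apply: ler_wpM2l => //; apply: expR_ge1Dx.
have : lam * (1 - eta) * (Q * m) <= lam * (1 - eta) * \sum_(i | S i) y i.
  by apply: ler_wpM2l => //; apply: mulr_ge0; rewrite // subr_ge0.
lra.
Qed.

Lemma sum_expR_le (I : finType) (S : pred I) (y : I -> R) lam eta beta (Q m : R) :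
  0 <= lam -> lam * beta <= eta -> 0 <= eta <= 1 / 3 ->
  (forall i, S i -> 0 <= y i <= beta) ->
  \sum_(i | S i) 1 <= Q -> 0 <= Q -> \sum_(i | S i) y i <= Q * m ->
  \sum_(i | S i) expR (lam * y i) <= Q * expR (lam * (1 + 3 / 2 * eta) * m).
Proof.
move=> lam0 lb /andP[eta0 eta1] yb SQ Q0 Qm.
apply: (@le_trans _ _ (\sum_(i | S i) (1 + lam * (1 + 3 / 2 * eta) * y i))).
  apply: ler_sum => i /yb/andP[y0 ylb].
  have ly0 : 0 <= lam * y i by apply: mulr_ge0.
  have lyb : lam * y i <= eta by apply: le_trans lb; apply: ler_wpM2l.
  apply: le_trans (expR_le_quad _) _; first by rewrite ly0 (le_trans lyb).
  nra.
rewrite big_split -mulr_sumr /=.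
apply: (@le_trans _ _ (Q * (1 + lam * (1 + 3 / 2 * eta) * m))); last first.
  by apply: ler_wpM2l => //; apply: expR_ge1Dx.
have : lam * (1 + 3 / 2 * eta) * (\sum_(i | S i) y i)
    <= lam * (1 + 3 / 2 * eta) * (Q * m).
  by apply: ler_wpM2l => //; apply: mulr_ge0 => //; nra.
lra.
Qed.

(* [z] and [z'] are the degree of a vertex divided by its predicted value,
   before and after one step; [mu] is the predicted relative loss. *)
Lemma upper_drift z mu eta : 0 <= mu <= 1 / 2 -> 0 <= eta <= 1 / 3 -> 0 <= z <= 1 + eta ->
  z / (1 - mu) - (1 - eta) * (z * mu * (1 - 3 * eta) / (1 - mu)) <= z + 16 * mu * eta.
Proof.
move=> /andP[mu0 mu1] /andP[e0 e1] /andP[z0 z1].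
rewrite !mulrA -mulrBl ler_pdivrMr; last lra.
have me0 : 0 <= mu * eta by apply: mulr_ge0.
have zme : z * (mu * eta) <= 4 / 3 * (mu * eta) by apply: ler_wpM2r => //; lra.
have m2e : mu * (mu * eta) <= 1 / 2 * (mu * eta) by apply: ler_wpM2r.
have : 0 <= z * mu * eta * eta by rewrite !mulr_ge0.
nra.
Qed.

(** The constant 16 is 6 times 4/3 times 2: (1 + 3/2 eta)(1 + 3 eta) - 1 <= 6 eta, z <= 4/3 and 1/(1
    - mu) <= 2. *)
Lemma lower_drift z mu eta : 0 <= mu <= 1 / 2 -> 0 <= eta <= 1 / 3 -> 0 <= z <= 1 + eta ->
  (1 + 3 / 2 * eta) * (z * mu * (1 + 3 * eta) / (1 - mu)) - z / (1 - mu)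
    <= 16 * mu * eta - z.
Proof.
move=> /andP[mu0 mu1] /andP[e0 e1] /andP[z0 z1].
rewrite !mulrA -mulrBl ler_pdivrMr; last lra.
have me0 : 0 <= mu * eta by apply: mulr_ge0.
have zme0 : 0 <= z * (mu * eta) by apply: mulr_ge0.
have zme : z * (mu * eta) <= 4 / 3 * (mu * eta) by apply: ler_wpM2r => //; lra.
have m2e : mu * (mu * eta) <= 1 / 2 * (mu * eta) by apply: ler_wpM2r.
have : z * (mu * eta) * eta <= z * (mu * eta) * (1 / 3) by apply: ler_wpM2l.
nra.
Qed.

End ExponentialMoments.

Section OneStep.

Variables (R : realType) (V T : finType) (sh : T -> {set V}).
Variables (A : {set T}) (U : {set V}) (k c : nat) (x eta lam beta : R).

Hypothesis k_gt0 : (0 < k)%N.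
Hypothesis sh_card : {in A, forall e, #|sh e| = k}.
Hypothesis sh_sub : {in A, forall e, sh e \subset U}.
Hypothesis codegree_le :
  forall v w, v != w -> (#|star sh A v :&: star sh A w| <= c)%N.

Let X v : R := #|star sh A v|%:R.
Let M : R := #|U|%:R.
Let mu : R := k%:R * (k%:R - 1) / M.
Let x' : R := x * (1 - mu).
Let after K : {set T} := [set e in A | [disjoint sh e & sh K]].

Hypothesis x_gt0 : 0 < x.
Hypothesis eta_bounds : 0 <= eta <= 1 / 3.
Hypothesis mu_le : mu <= 1 / 2.
(** In units of [x'], [beta] bounds the drop of a degree in one step; with [lam_beta] this keeps the
    exponents small enough for the quadratic bounds. *)
Hypothesis jump_le : k%:R * c%:R <= beta * x'.
Hypothesis beta_bounds : 0 <= beta <= eta.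
Hypothesis lam_ge0 : 0 <= lam.
Hypothesis lam_beta : lam * beta <= eta.
Hypothesis degree_bounds : {in U, forall w, (1 - eta) * x <= X w <= (1 + eta) * x}.
Variable v : V.
Hypothesis vU : v \in U.

Let k1 : 1 <= k%:R :> R. Proof. by rewrite ler1n. Qed.

Let M_gt0 : 0 < M.
Proof. by rewrite ltr0n card_gt0; apply/set0Pn; exists v. Qed.

Let mu_ge0 : 0 <= mu.
Proof. by rewrite divr_ge0 ?ler0n // mulr_ge0 ?ler0n ?subr_ge0. Qed.

Let mu_lt1 : 0 < 1 - mu.
Proof. by move: mu_le; lra. Qed.

Let x'_gt0 : 0 < x'.
Proof. exact: mulr_gt0. Qed.

Lemma card_codegree_le : k%:R * c%:R <= eta * x.
Proof.
apply: le_trans jump_le _; case/andP: beta_bounds => b0 be.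
apply: ler_pM => //; first exact: ltW.
by rewrite ger_pMr // lerBlDr lerDl.
Qed.

Lemma degree_sum : k%:R * #|A|%:R = \sum_(w in U) X w.
Proof.
rewrite -natr_sum sum_card_star -natrM; congr _%:R.
rewrite mulnC -sum_nat_const; apply: eq_bigr => e eA.
by rewrite (setIidPr (sh_sub eA)) sh_card.
Qed.

Lemma card_edges_bounds :
  M * ((1 - eta) * x) <= k%:R * #|A|%:R <= M * ((1 + eta) * x).
Proof.
rewrite degree_sum /M -!sum1_card !natr_sum !mulr_suml.
by apply/andP; split; apply: ler_sum => w /degree_bounds/andP[]; rewrite mul1r.
Qed.

Lemma neighbourhood_card e : e \in star sh A v -> #|sh e :\ v|%:R = k%:R - 1 :> R.
Proof.
rewrite inE => /andP[eA ve]; move: (cardsD1 v (sh e)).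
by rewrite ve sh_card // => ->; rewrite add1n -natr1 addrK.
Qed.

Lemma neighbourhood_sub e w : e \in star sh A v -> w \in sh e :\ v -> w \in U.
Proof.
rewrite !inE => /andP[eA _] /andP[_ we].
exact: (subsetP (sh_sub eA)).
Qed.

(** Each of the [X v] edges at [v] has [k - 1] other vertices, of degree at most (1 + eta) x, while
    [#|A|] is at least M (1 - eta) x / k. Finally 1 + eta <= (1 - eta)(1 + 3 eta), since eta <=
    1/3. *)
Lemma lost_le : (lost sh A v)%:R <= #|A|%:R * (X v * mu * (1 + 3 * eta)).
Proof.
apply: (@le_trans _ _ (X v * ((k%:R - 1) * ((1 + eta) * x)))).
  rewrite lostE natr_sum /X -sum1_card natr_sum mulr_suml.
  apply: ler_sum => e es; rewrite mul1r.
  apply: le_trans (_ : (\sum_(w in sh e :\ v) #|star sh A w|)%:R <= _).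
    by rewrite ler_nat card_hit_le //; case/setIdP: es.
  rewrite natr_sum -(neighbourhood_card es) -sum1_card natr_sum mulr_suml.
  apply: ler_sum => w /(neighbourhood_sub es) wU; rewrite mul1r.
  by case/andP: (degree_bounds wU).
have /andP[+ _] := card_edges_bounds => Ak.
have -> : #|A|%:R * (X v * mu * (1 + 3 * eta))
    = X v * ((k%:R - 1) * (k%:R * #|A|%:R / M * (1 + 3 * eta))).
  by rewrite /mu; ring.
apply: ler_wpM2l; first exact: ler0n.
apply: ler_wpM2l; first by rewrite subr_ge0.
apply: (@le_trans _ _ ((1 - eta) * x * (1 + 3 * eta))); last first.
  apply: ler_wpM2r; first by move: eta_bounds; lra.
  by rewrite ler_pdivlMr // mulrC.
rewrite mulrAC; apply: ler_wpM2r; first exact: ltW.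
move: eta_bounds; nra.
Qed.

(** The correction in [card_hit_ge] is at most eta x per neighbour by [card_codegree_le], which
    leaves (1 - 2 eta) x; and (1 + eta)(1 - 3 eta) <= 1 - 2 eta. *)
Lemma lost_ge : #|A|%:R * (X v * mu * (1 - 3 * eta)) <= (lost sh A v)%:R.
Proof.
apply: (@le_trans _ _ (X v * ((k%:R - 1) * ((1 - 2 * eta) * x)))); last first.
  rewrite lostE natr_sum /X -sum1_card natr_sum mulr_suml.
  apply: ler_sum => e es; rewrite mul1r.
  have ve : v \in sh e by move: es; rewrite inE => /andP[].
  have := card_hit_ge A ve; rewrite -(ler_nat R) natrD.
  rewrite -lerBlDr; apply: le_trans.
  rewrite !natr_sum -sumrB -(neighbourhood_card es) -sum1_card natr_sum mulr_suml.
  apply: ler_sum => w wB; rewrite mul1r.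
  have /degree_bounds/andP[+ _] := neighbourhood_sub es wB.
  suff : (\sum_(w' in sh e :\ w) #|star sh A w :&: star sh A w'|)%:R <= eta * x.
    rewrite /X; lra.
  apply: le_trans card_codegree_le; rewrite -natrM ler_nat.
  apply: (@leq_trans (\sum_(w' in sh e :\ w) c)%N).
    by apply: leq_sum => w'; rewrite !inE eq_sym => /andP[/codegree_le].
  rewrite sum_nat_const leq_mul2r; apply/orP; right.
  case/setIdP: es => eA _.
  by rewrite -(sh_card eA) subset_leq_card // subD1set.
have /andP[_ +] := card_edges_bounds => Ak.
have -> : #|A|%:R * (X v * mu * (1 - 3 * eta))
    = X v * ((k%:R - 1) * (k%:R * #|A|%:R / M * (1 - 3 * eta))).
  by rewrite /mu; ring.
apply: ler_wpM2l; first exact: ler0n.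
apply: ler_wpM2l; first by rewrite subr_ge0.
apply: (@le_trans _ _ ((1 + eta) * x * (1 - 3 * eta))).
  apply: ler_wpM2r; first by move: eta_bounds; lra.
  by rewrite ler_pdivrMr // [leRHS]mulrC.
rewrite mulrAC; apply: ler_wpM2r; first exact: ltW.
move: eta_bounds; nra.
Qed.

Let loss K : R := #|star sh A v :&: hit sh A K|%:R / x'.

Let loss_bounds K : (K \in A) && (v \notin sh K) -> 0 <= loss K <= beta.
Proof.
move=> /andP[KA vK]; rewrite /loss divr_ge0 ?ler0n ?(ltW x'_gt0) //=.
rewrite ler_pdivrMr //; apply: le_trans jump_le.
by rewrite -natrM ler_nat (card_star_hit_le (sh_card KA) vK) // => w; apply: codegree_le.
Qed.

Let sum_loss : \sum_(K in A | v \notin sh K) loss K = (lost sh A v)%:R / x'.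
Proof. by rewrite -mulr_suml -natr_sum. Qed.

Let card_survive : \sum_(K in A | v \notin sh K) 1 <= #|A|%:R :> R.
Proof.
rewrite -sumr_const; rewrite big_mkcondr; apply: ler_sum => K _.
by case: ifP.
Qed.

Let degree_after K : #|star sh (after K) v|%:R / x' = X v / x' - loss K.
Proof. by rewrite /X -(card_star_diff sh A v K) natrD mulrDl addrK. Qed.

Let ratio_bounds : 0 <= X v / x <= 1 + eta.
Proof.
rewrite divr_ge0 ?ler0n ?(ltW x_gt0) //= ler_pdivrMr //.
by case/andP: (degree_bounds vU).
Qed.

(** In units of [x'] the new degree is [X v / x' - loss K], so a constant factor comes out and the
    sum of [expR (- (lam * loss K))] remains; [upper_drift] compares the resulting exponents. *)
Lemma upper_step :
  \sum_(K in A | v \notin sh K)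
     expR (lam * (#|star sh (after K) v|%:R / x' - 1 - eta * (1 + 16 * mu)))
  <= #|A|%:R * expR (lam * (X v / x - 1 - eta)).
Proof.
pose m := X v / x * mu * (1 - 3 * eta) / (1 - mu).
have H : #|A|%:R * m <= \sum_(K in A | v \notin sh K) loss K.
  rewrite sum_loss ler_pdivlMr //.
  apply: le_trans lost_ge; rewrite le_eqVlt; apply/orP; left; apply/eqP.
  rewrite /m /x'; by field; rewrite !gt_eqF.
have eta1 : eta <= 1 by move: eta_bounds; lra.
have := sum_expRN_le lam_ge0 lam_beta eta1 loss_bounds card_survive (ler0n _ _) H.
have ex : 0 <= expR (lam * (X v / x' - 1 - eta * (1 + 16 * mu))) by apply: expR_ge0.
move=> /(ler_wpM2l ex); rewrite mulr_sumr.
under eq_bigr => K _.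
  rewrite -expRD -(mulrN lam) -mulrDr.
  rewrite (_ : _ - loss K = #|star sh (after K) v|%:R / x' - 1 - eta * (1 + 16 * mu)).
    over.
  by rewrite degree_after; ring.
move/le_trans; apply.
rewrite mulrCA -expRD; apply: ler_wpM2l; first exact: ler0n.
rewrite ler_expR -mulrA -(mulrN lam) -mulrDr; apply: ler_wpM2l => //.
have := upper_drift (introT andP (conj mu_ge0 mu_le)) eta_bounds ratio_bounds.
rewrite -/m.
have -> : X v / x / (1 - mu) = X v / x' by rewrite /x' invfM mulrA.
lra.
Qed.

Lemma lower_step :
  \sum_(K in A | v \notin sh K)
     expR (lam * (1 - #|star sh (after K) v|%:R / x' - eta * (1 + 16 * mu)))
  <= #|A|%:R * expR (lam * (1 - X v / x - eta)).
Proof.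
pose m := X v / x * mu * (1 + 3 * eta) / (1 - mu).
have H : \sum_(K in A | v \notin sh K) loss K <= #|A|%:R * m.
  rewrite sum_loss ler_pdivrMr //.
  apply: le_trans lost_le _; rewrite le_eqVlt; apply/orP; left; apply/eqP.
  rewrite /m /x'; by field; rewrite !gt_eqF.
have := sum_expR_le lam_ge0 lam_beta eta_bounds loss_bounds card_survive (ler0n _ _) H.
have ex : 0 <= expR (lam * (1 - X v / x' - eta * (1 + 16 * mu))) by apply: expR_ge0.
move=> /(ler_wpM2l ex); rewrite mulr_sumr.
under eq_bigr => K _.
  rewrite -expRD -mulrDr.
  rewrite (_ : _ + loss K = 1 - #|star sh (after K) v|%:R / x' - eta * (1 + 16 * mu)).
    over.
  by rewrite degree_after; ring.
move/le_trans; apply.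
rewrite mulrCA -expRD; apply: ler_wpM2l; first exact: ler0n.
rewrite ler_expR -mulrA -mulrDr; apply: ler_wpM2l => //.
have := lower_drift (introT andP (conj mu_ge0 mu_le)) eta_bounds ratio_bounds.
rewrite -/m.
have -> : X v / x / (1 - mu) = X v / x' by rewrite /x' invfM mulrA.
lra.
Qed.

End OneStep.

(** * The exponential supermartingale *)

Section Law.

Variables (R : realFieldType) (n q : nat).
Implicit Types (H K : {set {set 'I_n}}).

Lemma linear_step_expect H (f : {set {set 'I_n}} -> R) :
  available q H != set0 ->
  \sum_K linear_step R q H K * f K
    = (\sum_(e in available q H) f (e |: H)) / #|available q H|%:R.
Proof.
move=> /negbTE A0; rewrite /linear_step A0.
under eq_bigr do rewrite mulr_suml.
rewrite exchange_big mulr_suml; apply: eq_bigr => e _ /=.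
rewrite (bigD1 (e |: H)) //= eqxx big1 ?addr0 ?mul1r 1?mulrC // => K /negbTE ->.
by rewrite !mul0r.
Qed.

Lemma linear_law_submartingale (u : nat -> {set {set 'I_n}} -> R) (t : nat) :
  (forall s H, (s < t)%N -> u s H <= \sum_K linear_step R q H K * u s.+1 K) ->
  u 0 set0 <= \sum_H linear_law R q t H * u t H.
Proof.
elim: t => [_|t IH sub] /=.
  rewrite (bigD1 set0) //= eqxx mul1r lerDl sumr_ge0 // => H /negbTE->.
  by rewrite mul0r.
apply: le_trans (IH _) _ => [s H st|]; first exact/sub/ltnW.
under [leRHS]eq_bigr do rewrite mulr_suml.
rewrite exchange_big; apply: ler_sum => H _ /=.
under eq_bigr do rewrite -mulrA.
by rewrite -mulr_sumr ler_wpM2l ?linear_law_ge0 // sub.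
Qed.

(** From [G] only [G] itself and the sets [e |: G] can be reached, so edges are never lost. This
    carries the bound from time [T] to the end of the process. *)
Lemma linear_law_card_mono (m s t : nat) : (s <= t)%N ->
  \sum_(H : {set {set 'I_n}} | (m <= #|H|)%N) linear_law R q s H
    <= \sum_(H : {set {set 'I_n}} | (m <= #|H|)%N) linear_law R q t H.
Proof.
elim: t => [|t IH]; first by rewrite leqn0 => /eqP->.
rewrite leq_eqVlt => /orP[/eqP-> //|/IH]; move/le_trans; apply => /=.
rewrite [leRHS]exchange_big [leLHS]big_mkcond; apply: ler_sum => G _ /=.
rewrite -mulr_sumr; case: ifP => [mG|_]; last first.
  by rewrite mulr_ge0 ?linear_law_ge0 ?sumr_ge0 // => K _; apply: linear_step_ge0.
rewrite ler_peMr ?linear_law_ge0 //.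
rewrite -(linear_step_sum1 R q G) [leRHS]big_mkcond.
apply: ler_sum => K _; case: ifPn => //; rewrite -ltnNge => Km.
suff : K != G /\ forall e, K != e |: G.
  case=> /negbTE KG /(_ _)/negbTE Ke; rewrite /linear_step KG.
  by case: ifP => // _; rewrite big1 // => e _; rewrite Ke mul0r.
split=> [|e]; apply: contraTneq Km => ->; rewrite -leqNgt //.
by rewrite (leq_trans mG) // subset_leq_card // subsetUr.
Qed.

End Law.

Section Potential.

Variables (R : realType) (n q T : nat).
Variables (x eta : nat -> R) (lam beta : R).
Implicit Types (H : {set {set 'I_n}}) (v : {set 'I_n}) (t : nat).

Let k := 'C(q, 2).
Let N := 'C(n, 2).
Let c := ('C(n - 2, q - 2) * (q - 2) %/ (n - 2))%N.
Let mu t : R := k%:R * (k%:R - 1) / (N%:R - k%:R * t%:R).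

Hypothesis q_gt1 : (1 < q)%N.
Hypothesis x0 : x 0 = 'C(n - 2, q - 2)%:R.
Hypothesis T_bound : (k * T < N)%N.
Hypothesis x_gt0 : forall t, (t <= T)%N -> 0 < x t.
Hypothesis xS : forall t, (t < T)%N -> x t.+1 = x t * (1 - mu t).
Hypothesis mu_le : forall t, (t < T)%N -> mu t <= 1 / 2.
Hypothesis eta_le : forall t, (t <= T)%N -> beta <= eta t <= 1 / 3.
Hypothesis etaS : forall t, (t < T)%N -> eta t * (1 + 16 * mu t) <= eta t.+1.
Hypothesis beta_ge0 : 0 <= beta.
Hypothesis jump_le : forall t, (t < T)%N -> k%:R * c%:R <= beta * x t.+1.
Hypothesis lam_ge0 : 0 <= lam.
Hypothesis lam_beta : forall t, (t <= T)%N -> lam * beta <= eta t.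

(** One of the two terms is at least 1 as soon as [z / x t] leaves the interval from [1 - eta t] to
    [1 + eta t]. *)
Definition deviation t (z : R) : R :=
  expR (lam * (z / x t - 1 - eta t)) + expR (lam * (1 - z / x t - eta t)).

Definition potential t H : R :=
  \sum_(v in uncovered H) deviation t #|star shadow (available q H) v|%:R.

(** The second condition says that each of the [t] edges covered [k] new pairs. It fixes the number
    of uncovered pairs and hence the rate [mu t]; the additive form avoids truncated subtraction. *)
Definition typical t H : bool := (#|H| == t) && (#|uncovered H| + k * t == N)%N.

(* Being cut off at 0 wherever the one-step estimate fails, the score is a
   submartingale everywhere and no stopping time is needed. *)
Definition score t H : R :=
  if typical t H then Num.max 0 (1 - potential t H) else 0.

Lemma score_ge0 t H : 0 <= score t H.
Proof. by rewrite /score; case: ifP => // _; rewrite le_max lexx. Qed.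

Lemma deviation_ge0 t z : 0 <= deviation t z.
Proof. by rewrite addr_ge0 ?expR_ge0. Qed.

Lemma potential_ge0 t H : 0 <= potential t H.
Proof. by apply: sumr_ge0 => v _; apply: deviation_ge0. Qed.

Lemma score_le t H : score t H <= (t <= #|H|)%N%:R.
Proof.
rewrite /score; case: ifP => [/andP[/eqP-> _]|_]; last exact: ler0n.
by rewrite leqnn ge_max ler01 gerBl potential_ge0.
Qed.

Lemma degree_bounds t H v : (t <= T)%N -> potential t H < 1 -> v \in uncovered H ->
  (1 - eta t) * x t <= #|star shadow (available q H) v|%:R <= (1 + eta t) * x t.
Proof.
move=> tT P1 vU; set z := _%:R.
have : deviation t z < 1.
  apply: le_lt_trans P1; rewrite /potential (bigD1 v) //= lerDl.
  by apply: sumr_ge0 => w _; apply: deviation_ge0.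
have xt := x_gt0 tT.
have expR_lt1_lam a : expR (lam * a) < 1 -> a <= 0.
  rewrite expR_lt1; apply: contraTT; rewrite -!ltNge => /ltW a0.
  by rewrite -leNgt mulr_ge0.
have e1 := expR_ge0 (lam * (z / x t - 1 - eta t)).
have e2 := expR_ge0 (lam * (1 - z / x t - eta t)).
rewrite /deviation => d1.
have /expR_lt1_lam h1 : expR (lam * (z / x t - 1 - eta t)) < 1 by lra.
have /expR_lt1_lam h2 : expR (lam * (1 - z / x t - eta t)) < 1 by lra.
apply/andP; split; [rewrite -ler_pdivlMr // | rewrite -ler_pdivrMr //]; lra.
Qed.

(** Where the score is 0 there is nothing to prove. Otherwise the potential is below 1, so all
    degrees are within bounds and [upper_step] and [lower_step] apply to every uncovered pair. *)
Lemma score_step t H : (t < T)%N ->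
  score t H <= \sum_K linear_step R q H K * score t.+1 K.
Proof.
move=> tT; set S := \sum_K _.
have S0 : 0 <= S.
  by apply: sumr_ge0 => K _; rewrite mulr_ge0 ?linear_step_ge0 ?score_ge0.
rewrite /score; case: ifP => [/andP[/eqP Ht /eqP UN]|_ //].
have [P1|P1] := ltP (potential t H) 1; last first.
  by rewrite max_l // subr_le0.
rewrite max_r ?subr_ge0 ?(ltW P1) // {S0}/S.
set A := available q H.
have tT' := ltnW tT.
have xt := x_gt0 tT'.
have k0 : (0 < k)%N by rewrite bin_gt0.
have shk : {in A, forall e, #|shadow e| = k}.
  by move=> e; rewrite inE => /andP[/eqP eq _]; rewrite card_shadow eq.
have shU : {in A, forall e, shadow e \subset uncovered H}.
  by move=> e; apply: shadow_sub_uncovered.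
have cod v w : v != w -> (#|star shadow A v :&: star shadow A w| <= c)%N.
  exact: codegree_bound.
have deg := degree_bounds tT' P1.
have UE : #|uncovered H|%:R = N%:R - k%:R * t%:R :> R.
  by rewrite -UN natrD natrM addrK.
have U0 : (0 < #|uncovered H|)%N.
  have : (k * t < k * T)%N by rewrite ltn_pmul2l.
  move: T_bound UN; lia.
have eb : 0 <= eta t <= 1 / 3.
  by have /andP[be ->] := eta_le tT'; rewrite (le_trans beta_ge0 be).
(* The process has not terminated: an uncovered pair exists and its degree is positive. *)
have A0 : A != set0.
  have [v vU] := card_gt0P U0.
  have /andP[+ _] := deg v vU; rewrite -/A; apply: contraTneq => ->.
  rewrite -ltNge (_ : star _ _ _ = set0) ?cards0; last first.
    by apply/setP => e; rewrite !inE.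
  by rewrite mulr_gt0 //; move: eb; lra.
have A1 : 0 < #|A|%:R :> R by rewrite ltr0n card_gt0.
rewrite linear_step_expect // -/A. rewrite ler_pdivlMr //.
apply: (@le_trans _ _ (\sum_(e in A) (1 - potential t.+1 (e |: H)))); last first.
  apply: ler_sum => e eA; rewrite /score.
  have -> : typical t.+1 (e |: H).
    apply/andP; split.
      by rewrite cardsU1 (available_notin q_gt1 eA) Ht add1n.
    rewrite uncoveredU1 cardsDS ?shU // shk // -UN mulnS addnA subnK //.
    by rewrite -(shk e eA) subset_leq_card ?shU.
  by rewrite le_max lexx orbT.
rewrite sumrB sumr_const mulrBl mul1r lerD2l lerN2.
pose after e : {set {set 'I_n}} := [set f in A | [disjoint shadow f & shadow e]].
(* After the exchange, a pair covered by [e] has left the potential, so each [v] is summed only over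
   the edges avoiding it. *)
have -> : \sum_(e in A) potential t.+1 (e |: H) = \sum_(v in uncovered H)
    \sum_(e in A | v \notin shadow e) deviation t.+1 #|star shadow (after e) v|%:R.
  rewrite [RHS](exchange_big_dep (fun e => e \in A)) //=; last by move=> v e _ /andP[].
  apply: eq_bigr => e eA.
  rewrite /potential uncoveredU1 availableU1 -/A -/(after e).
  by apply: eq_bigl => v; rewrite inE eA andbC.
rewrite mulr_suml; apply: ler_sum => v vU; rewrite big_split mulrDl /=.
have muE : k%:R * (k%:R - 1) / #|uncovered H|%:R = mu t by rewrite UE.
have mul : k%:R * (k%:R - 1) / #|uncovered H|%:R <= 1 / 2 :> R.
  by rewrite muE; apply: mu_le.
have jl : k%:R * c%:R <=
    beta * (x t * (1 - k%:R * (k%:R - 1) / #|uncovered H|%:R)).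
  by rewrite muE -xS //; apply: jump_le.
have bb : 0 <= beta <= eta t by rewrite beta_ge0; case/andP: (eta_le tT').
have := upper_step k0 shk shU cod xt eb mul jl bb lam_ge0 (lam_beta tT') deg vU.
have := lower_step k0 shk shU cod xt eb mul jl lam_ge0 (lam_beta tT') deg vU.
rewrite muE -xS // => low up.
apply: lerD; rewrite mulrC; [apply: le_trans up | apply: le_trans low].
  apply: ler_sum => e _; rewrite ler_expR; apply: ler_wpM2l => //.
  by rewrite lerD2l lerN2 etaS.
apply: ler_sum => e _; rewrite ler_expR; apply: ler_wpM2l => //.
by rewrite lerD2l lerN2 etaS.
Qed.

(** Initially every degree equals [x 0], so each pair contributes [2 * expR (- (lam * eta 0))] to
    the potential; at time [T] the score is at most the indicator of the event. *)
Lemma card_ge_prob :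
  1 - 2 * N%:R * expR (- (lam * eta 0))
    <= \sum_(H : {set {set 'I_n}} | (T <= #|H|)%N) linear_law R q T H.
Proof.
apply: (@le_trans _ _ (score 0 set0)).
  have card0 : #|uncovered (set0 : {set {set 'I_n}})| = N.
    by rewrite uncovered0 card_draws card_ord.
  rewrite /score /typical cards0 card0 muln0 addn0 !eqxx /= le_max; apply/orP; right.
  rewrite lerD2l lerN2 /potential mulrAC mulr_natr -card0 -sumr_const.
  apply: ler_sum => v vU; rewrite degree0 // -x0 /deviation divff ?gt_eqF ?x_gt0 //.
  rewrite subrr sub0r mulrN; lra.
apply: le_trans (linear_law_submartingale (u := score) (t := T) _) _.
  by move=> s H; apply: score_step.
rewrite [leRHS]big_mkcond; apply: ler_sum => H _.
apply: (@le_trans _ _ (linear_law R q T H * (T <= #|H|)%N%:R)).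
  by rewrite ler_wpM2l ?linear_law_ge0 ?score_le.
by case: ifP; rewrite ?mulr1 ?mulr0.
Qed.

End Potential.

(** * Choice of the constants *)

Section Constants.

Variables (R : realType) (n q T : nat) (eps : R).

Let k := 'C(q, 2).
Let N := 'C(n, 2).
Let D := 'C(n - 2, q - 2).
Let kappa : R := k%:R / eps.
Let L : R := ln n%:R.
Let mu t : R := k%:R * (k%:R - 1) / (N%:R - k%:R * t%:R).
Let mu_max : R := k%:R ^+ 2 / (eps * N%:R).

Hypothesis q_gt1 : (1 < q)%N.
Hypothesis q_le_n : (q <= n)%N.
Hypothesis n_gt2 : (2 < n)%N.
Hypothesis eps_bounds : 0 < eps < 1.
Hypothesis T_le : k%:R * T%:R <= (1 - eps) * N%:R.
Hypothesis k_small : 2 * k%:R ^+ 2 <= eps * N%:R.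
Hypothesis L_ge1 : 1 <= L.
Hypothesis n_large :
  27 * L * (k%:R * (q - 2)%N%:R) * expR (34 * kappa) <= (n - 2)%N%:R.

Lemma expRN2_le (y : R) : 0 <= y <= 1 / 2 -> expR (- (2 * y)) <= 1 - y.
Proof.
move=> /andP[y0 y1]; rewrite expRN -[leRHS]invrK lef_pV2 ?posrE ?invr_gt0 ?expR_gt0 //; last lra.
apply: le_trans (expR_ge1Dx (2 * y)); rewrite -div1r ler_pdivrMr; last lra.
nra.
Qed.

Let eps_gt0 : 0 < eps. Proof. by case/andP: eps_bounds. Qed.

Let k_ge1 : 1 <= k%:R :> R.
Proof. by rewrite ler1n bin_gt0. Qed.

Let N_gt0 : 0 < N%:R :> R.
Proof. by rewrite ltr0n bin_gt0 (leq_trans q_gt1). Qed.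

Let epsN_gt0 : 0 < eps * N%:R. Proof. exact: mulr_gt0. Qed.

Let kappa_ge0 : 0 <= kappa.
Proof. by rewrite divr_ge0 ?ler0n ?(ltW eps_gt0). Qed.

Let mu_max_bounds : 0 <= mu_max <= 1 / 2.
Proof.
rewrite /mu_max divr_ge0 ?(ltW epsN_gt0) ?sqr_ge0 //= ler_pdivrMr //.
move: k_small; lra.
Qed.

(** Before time [T] at least [eps * N] pairs are uncovered. *)
Let mu_bounds t : (t < T)%N -> 0 <= mu t <= mu_max.
Proof.
move=> tT; have kt : k%:R * t%:R <= k%:R * T%:R :> R.
  by rewrite ler_wpM2l ?ler0n // ler_nat ltnW.
have den : eps * N%:R <= N%:R - k%:R * t%:R by move: T_le; lra.
have den0 : 0 < N%:R - k%:R * t%:R := lt_le_trans epsN_gt0 den.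
apply/andP; split.
  by rewrite divr_ge0 ?(ltW den0) ?mulr_ge0 ?subr_ge0 ?ler0n.
apply: ler_pM; rewrite ?invr_ge0 ?(ltW den0) ?mulr_ge0 ?subr_ge0 ?ler0n //.
  by rewrite expr2; move: k_ge1; nra.
by rewrite lef_pV2 ?posrE.
Qed.

Let mu_max_T t : (t <= T)%N -> mu_max * t%:R <= kappa.
Proof.
move=> tT; apply: (@le_trans _ _ (mu_max * T%:R)).
  by rewrite ler_wpM2l ?ler_nat //; case/andP: mu_max_bounds.
rewrite /mu_max mulrAC ler_pdivrMr // /kappa.
have -> : k%:R / eps * (eps * N%:R) = k%:R * N%:R.
  by rewrite mulrA mulfVK ?gt_eqF.
rewrite expr2 -mulrA ler_wpM2l ?ler0n //; apply: le_trans T_le _.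
rewrite ger_pMl //; move: eps_gt0; lra.
Qed.

Let x t : R := D%:R * \prod_(s < t) (1 - mu s).
(* [eta] stays below 1/3 because [mu_max * T <= kappa]; [beta * x] bounds the
   one-step drop of a degree because [x >= D exp (- 2 kappa)]; [lam] makes the
   initial potential [2 N exp (- 3 L)]. *)
Let eta t : R := expR (- (16 * kappa)) / 3 * (1 + 16 * mu_max) ^+ t.
Let beta : R := k%:R * (q - 2)%N%:R / (n - 2)%N%:R * expR (2 * kappa).
Let lam : R := 9 * L * expR (16 * kappa).

Let D_gt0 : 0 < D%:R :> R.
Proof. by rewrite ltr0n bin_gt0 leq_sub2r. Qed.

Let x_ge t : (t <= T)%N -> D%:R * expR (- (2 * kappa)) <= x t.
Proof.
move=> tT; rewrite /x ler_wpM2l ?ler0n //.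
apply: (@le_trans _ _ (\prod_(s < t) expR (- (2 * mu_max)))).
  rewrite prodr_const card_ord -expRM_natr ler_expR mulNr lerN2 -mulrA.
  by rewrite ler_wpM2l // mu_max_T.
apply: ler_prod => s _; rewrite expR_ge0 /=.
have /andP[m0 mm] := mu_bounds (leq_trans (ltn_ord s) tT).
apply: le_trans (expRN2_le mu_max_bounds) _.
by rewrite lerD2l lerN2.
Qed.

Let eta_ge t : eta 0 <= eta t.
Proof.
rewrite /eta expr0 mulr1 ler_peMr ?divr_ge0 ?expR_ge0 //.
apply: exprn_ege1; case/andP: mu_max_bounds => m0 _; lra.
Qed.

Let eta_le3 t : (t <= T)%N -> eta t <= 1 / 3.
Proof.
move=> tT; rewrite /eta mulrAC ler_wpM2r ?invr_ge0 //.
rewrite mulrC expRN ler_pdivrMr ?expR_gt0 // mul1r.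
apply: (@le_trans _ _ (expR (16 * mu_max) ^+ t)).
  apply: lerXn2r; rewrite ?nnegrE ?expR_ge0 ?expR_ge1Dx //.
  by case/andP: mu_max_bounds => m0 _; lra.
by rewrite -expRM_natr ler_expR -mulrA ler_wpM2l // mu_max_T.
Qed.

Let n2_gt0 : 0 < (n - 2)%N%:R :> R.
Proof. by rewrite ltr0n subn_gt0. Qed.

Let beta_ge0 : 0 <= beta.
Proof. by rewrite mulr_ge0 ?expR_ge0 ?divr_ge0 ?mulr_ge0 ?ler0n. Qed.

(** This is [n_large] rearranged: 27 = 9 * 3, and 34 = 16 + 16 + 2 collects the exponents of [lam],
    of the inverse of [eta 0] and of [beta]. *)
Let lam_beta0 : lam * beta <= eta 0.
Proof.
have E : expR (34 * kappa)
    = expR (16 * kappa) * expR (16 * kappa) * expR (2 * kappa).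
  by rewrite -!expRD; congr expR; ring.
rewrite /eta expr0 mulr1 expRN mulrC ler_pdivlMr // -[leRHS]mul1r.
rewrite ler_pdivlMr ?expR_gt0 //.
have -> : beta * lam * 3 * expR (16 * kappa)
  = 27 * L * (k%:R * (q - 2)%N%:R) * expR (34 * kappa) / (n - 2)%N%:R.
  by rewrite /beta /lam E; ring.
by rewrite ler_pdivrMr // mul1r.
Qed.

Let lam_ge1 : 1 <= lam.
Proof.
have e1 : 1 <= expR (16 * kappa).
  have := expR_ge1Dx (16 * kappa); move: kappa_ge0; lra.
rewrite /lam; move: L_ge1; nra.
Qed.

Lemma card_ge_prob_explicit :
  1 - 2 * N%:R * expR (- (3 * L))
    <= \sum_(H : {set {set 'I_n}} | (T <= #|H|)%N) linear_law R q T H.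
Proof.
have e16 : 0 < expR (16 * kappa) by apply: expR_gt0.
have -> : 3 * L = lam * eta 0.
  rewrite /lam /eta expr0 mulr1 expRN; by field; rewrite gt_eqF.
apply: (@card_ge_prob R n q T x eta lam beta) => //.
- by rewrite /x big_ord0 mulr1.
- rewrite -(ltr_nat R) natrM; apply: le_lt_trans T_le _.
  by rewrite gtr_pMl // gtrBl.
- by move=> t tT; apply: lt_le_trans (x_ge tT); rewrite mulr_gt0 ?expR_gt0.
- by move=> t tT; rewrite /x big_ord_recr mulrA.
- move=> t /mu_bounds/andP[_ mm]; apply: le_trans mm _.
  by case/andP: mu_max_bounds.
- move=> t tT; rewrite eta_le3 // andbT; apply: le_trans (eta_ge t).
  by apply: le_trans lam_beta0; rewrite ler_peMl.
- move=> t /mu_bounds/andP[m0 mm]; rewrite /eta exprSr mulrA ler_wpM2l //.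
    rewrite mulr_ge0 ?exprn_ge0 ?divr_ge0 ?expR_ge0 //.
    by case/andP: mu_max_bounds => ? _; lra.
  by rewrite lerD2l ler_wpM2l.
- move=> t tT; apply: (@le_trans _ _ (beta * (D%:R * expR (- (2 * kappa))))).
    rewrite /beta -/D expRN.
    have -> : k%:R * (q - 2)%N%:R / (n - 2)%N%:R * expR (2 * kappa)
        * (D%:R / expR (2 * kappa))
      = k%:R * (D%:R * (q - 2)%N%:R / (n - 2)%N%:R) :> R.
      by field; rewrite !gt_eqF ?expR_gt0.
    rewrite ler_wpM2l ?ler0n // ler_pdivlMr // -!natrM ler_nat.
    exact: leq_divM.
  by rewrite ler_wpM2l // x_ge.
- exact: le_trans lam_ge1.
- by move=> t _; apply: le_trans (eta_ge t).
Qed.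

End Constants.

(** * Explicit bounds for large n, with eps = q / sqrt(log n) *)

Lemma natr_bin2 (R : numFieldType) (m : nat) : (0 < m)%N ->
  'C(m, 2)%:R = m%:R * (m%:R - 1) / 2 :> R.
Proof.
move=> m0; apply: (mulIf (x := 2)); rewrite ?pnatr_eq0 // mulfVK ?pnatr_eq0 //.
by rewrite -natrM -(natrB _ m0) -natrM subn1 -[m.-1]bin1 mul_bin_diag mulnC.
Qed.

(** Positive probability exhibits a set of at least [m] distinct [q]-sets. Applied with [m = T], it
    shows that [T] is not later than the time at which the output is read. *)
Lemma linear_law_card_le (R : realFieldType) (n q m t : nat) : (1 < q)%N ->
  0 < \sum_(H : {set {set 'I_n}} | (m <= #|H|)%N) linear_law R q t H ->
  (m <= 'C(n, q))%N.
Proof.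
move=> q1; rewrite ltNge; apply: contraNT; rewrite -ltnNge => Cm.
apply: sumr_le0 => H mH; rewrite le_eqVlt; apply/orP; left.
apply: contraLR Cm => /(linear_law_supp q1)[/subset_leq_card + _].
by rewrite card_draws card_ord -leqNgt; apply: leq_trans.
Qed.

Section Asymptotics.

Variables (R : realType) (n q : nat).
Let L : R := ln n%:R.
Let r : R := q%:R / Num.sqrt L.
Let k := 'C(q, 2).
Let N := 'C(n, 2).

Hypothesis q_gt1 : (1 < q)%N.
Hypothesis L_ge64 : 64 <= L.
Hypothesis r_le : r <= 1 / 68.

Let sqrtL_gt0 : 0 < Num.sqrt L.
Proof. by rewrite sqrtr_gt0; move: L_ge64; lra. Qed.

Let n_gt0 : (0 < n)%N.
Proof.
rewrite lt0n; apply/eqP => n0; move: L_ge64; rewrite /L n0 ln0 //; lra.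
Qed.

Let nE : n%:R = expR L :> R.
Proof. by rewrite lnK // posrE ltr0n. Qed.

Let r_gt0 : 0 < r.
Proof. by rewrite divr_gt0 // ltr0n ltnW. Qed.

Let qE : q%:R = r * Num.sqrt L.
Proof. by rewrite /r mulfVK ?gt_eqF. Qed.

Let q2E : q%:R ^+ 2 = r ^+ 2 * L.
Proof. by rewrite qE exprMn sqr_sqrtr //; move: L_ge64; lra. Qed.

Let q_ge2 : 2 <= q%:R :> R. Proof. by rewrite ler_nat. Qed.

Let q2_le : q%:R ^+ 2 <= L.
Proof.
have r2 : r ^+ 2 <= 1 by move: r_gt0 r_le; nra.
by rewrite q2E ler_piMl //; move: L_ge64; lra.
Qed.

Let q_le : q%:R <= L.
Proof. by apply: le_trans q2_le; rewrite expr2; move: q_ge2; nra. Qed.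

Let L_le : L <= n%:R - 1.
Proof. by rewrite nE; have := expR_ge1Dx L; lra. Qed.

Let kE : k%:R = q%:R * (q%:R - 1) / 2 :> R.
Proof. by rewrite natr_bin2 // ltnW. Qed.

Let NE : N%:R = n%:R * (n%:R - 1) / 2 :> R.
Proof. by rewrite natr_bin2. Qed.

Let k_le : k%:R <= r ^+ 2 * L / 2.
Proof. by rewrite kE -q2E; move: q_ge2; nra. Qed.

Let k_gt0 : 0 < k%:R :> R.
Proof. by rewrite ltr0n bin_gt0. Qed.

Let k_small : 2 * k%:R ^+ 2 <= r * N%:R.
Proof.
have kL : k%:R <= L / 2.
  by apply: le_trans k_le _; rewrite -q2E; move: q2_le; lra.
have LL : L * L <= n%:R * (n%:R - 1).
  by apply: ler_pM; move: L_ge64 L_le; lra.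
have rr : r ^+ 2 <= r by move: r_gt0 r_le; nra.
apply: (@le_trans _ _ (2 * (r ^+ 2 * L / 2 * (L / 2)))).
  rewrite expr2 ler_wpM2l // ler_pM ?ler0n //.
apply: (@le_trans _ _ (r ^+ 2 * N%:R)).
  have -> : 2 * (r ^+ 2 * L / 2 * (L / 2)) = r ^+ 2 * (L * L / 2) by field.
  by rewrite ler_wpM2l ?sqr_ge0 // NE; lra.
by rewrite ler_wpM2r ?ler0n.
Qed.

(** With y = n^(1/16), [L_ge64] gives y >= 5 and [r_le] gives 34 k / r <= 17 r L <= L / 4, so the
    exponential is at most y^4. The rest is at most 27 (16 y)^3 <= 27 y^9, and 27 y^13 <= y^16 -
    2. *)
Let n_large :
  27 * L * (k%:R * (q - 2)%N%:R) * expR (34 * (k%:R / r)) <= (n - 2)%N%:R.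
Proof.
pose y := expR (L / 16).
have y5 : 5 <= y by have := expR_ge1Dx (L / 16); rewrite -/y; move: L_ge64; lra.
have Ly : L <= 16 * y by have := expR_ge1Dx (L / 16); rewrite -/y; lra.
have n16 : n%:R = y ^+ 16 by rewrite nE -expRM_natr; congr expR; field.
have e4 : expR (34 * (k%:R / r)) <= y ^+ 4.
  rewrite -expRM_natr ler_expR.
  have kr : k%:R / r <= r * L / 2.
    rewrite ler_pdivrMr //; apply: le_trans k_le _.
    by rewrite le_eqVlt; apply/orP; left; apply/eqP; ring.
  move: r_le L_ge64; nra.
have kq : k%:R * (q - 2)%N%:R <= L ^+ 2.
  rewrite natrB // expr2; apply: ler_pM; rewrite ?ler0n ?subr_ge0 //.
    by rewrite kE; apply: le_trans q2_le; move: q_ge2; nra.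
  by move: q_le; lra.
have n2 : (1 < n)%N.
  by rewrite -(ltr_nat R); move: L_le L_ge64; lra.
rewrite (natrB _ n2) n16.
apply: (@le_trans _ _ (27 * (16 * y) ^+ 3 * y ^+ 4)).
  apply: ler_pM => //; rewrite ?mulr_ge0 ?ler0n ?expR_ge0 //.
    by move: L_ge64; lra.
  rewrite -mulrA ler_wpM2l // exprS; apply: ler_pM; rewrite ?mulr_ge0 ?ler0n //.
    by move: L_ge64; lra.
  apply: le_trans kq _; apply: lerXn2r; rewrite ?nnegrE //; move: L_ge64; lra.
have y3 : 28 <= y ^+ 3 by rewrite !exprS expr0; nra.
have y13 : 2 <= y ^+ 13.
  by apply: (@le_trans _ _ y); [lra | rewrite -[leLHS]expr1 ler_weXn2l //; lra].
apply: (@le_trans _ _ (27 * (y ^+ 3) ^+ 3 * y ^+ 4)).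
  rewrite ler_wpM2r ?exprn_ge0 ?expR_ge0 // ler_wpM2l //.
  by apply: lerXn2r; rewrite ?nnegrE ?exprn_ge0 ?expR_ge0 //; [lra | rewrite !exprS expr0; nra].
have -> : 27 * (y ^+ 3) ^+ 3 * y ^+ 4 = 27 * y ^+ 13 by ring.
have -> : y ^+ 16 = y ^+ 3 * y ^+ 13 by ring.
nra.
Qed.

Let T := Num.trunc ((1 - r) * N%:R / k%:R).

Let r_lt1 : r < 1. Proof. by move: r_le; lra. Qed.

Let T_le : k%:R * T%:R <= (1 - r) * N%:R.
Proof.
rewrite mulrC -ler_pdivlMr //.
by rewrite truncn_le ?divr_ge0 ?mulr_ge0 ?ler0n // subr_ge0 ltW.
Qed.

(** Leaving a fraction [r] of the pairs uncovered costs one [r]. Rounding in [T] costs less than 1,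
    which is at most r N / k by [k_small], hence the second [r]. *)
Let card_ge (m : nat) : (T <= m)%N ->
  (1 - 2 * r) * (n%:R * (n%:R - 1) / (q%:R * (q%:R - 1))) <= m%:R.
Proof.
move=> Tm.
have -> : n%:R * (n%:R - 1) / (q%:R * (q%:R - 1)) = N%:R / k%:R :> R.
  rewrite NE kE; field; rewrite !gt_eqF //; move: q_ge2; lra.
have : (1 - r) * N%:R / k%:R < m%:R + 1.
  by apply: lt_le_trans (truncnS_gt _) _; rewrite natr1 ler_nat ltnS.
have : 1 <= r * (N%:R / k%:R).
  rewrite mulrA ler_pdivlMr // mul1r.
  apply: le_trans k_small.
  have : 1 <= k%:R :> R by rewrite ler1n bin_gt0.
  nra.
rewrite -mulrA; lra.
Qed.

(** The failure probability is at most 2 N n^(-3) = (n - 1) / n^2 <= 1 / n. *)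
Lemma output_prob_ge :
  1 - n%:R^-1 <= output_prob R q (fun H : {set {set 'I_n}} =>
    (1 - 2 * r) * (n%:R * (n%:R - 1) / (q%:R * (q%:R - 1))) <= #|H|%:R).
Proof.
have n_gt2 : (2 < n)%N.
  by rewrite -(ltr_nat R); move: L_le L_ge64; lra.
have n0 : 0 < n%:R :> R by rewrite ltr0n.
have q_le_n : (q <= n)%N.
  by rewrite -(ler_nat R); move: L_le q_le; lra.
have L1 : 1 <= L by move: L_ge64; lra.
have rb : 0 < r < 1 by rewrite r_gt0.
have := card_ge_prob_explicit q_gt1 q_le_n n_gt2 rb T_le k_small L1 n_large.
have -> : expR (- (3 * L)) = n%:R ^- 3.
  by rewrite expRN expRM_natl -nE.
set P := \sum_(H | _) _ => P_ge.
have {}P_ge : 1 - n%:R^-1 <= P.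
  apply: le_trans P_ge; rewrite lerD2l lerN2 -/N NE.
  rewrite ler_pdivrMr ?exprn_gt0 //.
  rewrite !exprS expr0 mulr1 mulKf ?gt_eqF //.
  move: n0; nra.
have P_gt0 : 0 < P.
  apply: lt_le_trans P_ge; rewrite subr_gt0 invf_lt1 // ltr1n.
  exact: leq_trans n_gt2.
apply: le_trans P_ge _.
have := linear_law_card_mono R n q T (linear_law_card_le q_gt1 P_gt0).
move/le_trans; apply.
rewrite /output_prob /output_law.
rewrite [leLHS]big_mkcond [leRHS]big_mkcond; apply: ler_sum => H _.
case: ifP => [TH|_]; first by rewrite card_ge.
by case: ifP => // _; apply: linear_law_ge0.
Qed.

End Asymptotics.

(** * Passage to the limit *)

Lemma output_prob_le1 (R : realFieldType) (n q : nat) (A : pred {set {set 'I_n}}) :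
  output_prob R q A <= 1.
Proof.
rewrite -(linear_law_sum1 R n q 'C(n, q)) /output_prob big_mkcond.
apply: ler_sum => H _; case: ifP => // _; exact: linear_law_ge0.
Qed.

From mathcomp Require Import all_classical all_reals all_analysis.
Import Order.TTheory GRing.Theory Num.Theory.
Import numFieldNormedType.Exports.
Local Open Scope classical_set_scope.
Local Open Scope ring_scope.

Theorem theorem4 (R : realType) (q : nat -> nat)
  (q_ge2 : forall n : nat, (2 <= q n)%N)
  (q_small : (fun n : nat => (q n)%:R : R^o) =o_\oo
             (fun n : nat => Num.sqrt (ln (n%:R : R)) : R^o)) :
  exists delta : nat -> R,
    (delta n @[n --> \oo] --> (0 : R)) /\
    (output_prob R (q n) (fun H : {set {set 'I_n}} =>
       (1 - delta n) * ((n%:R * (n%:R - 1)) / ((q n)%:R * ((q n)%:R - 1)))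
         <= (#|H|%:R : R)) @[n --> \oo] --> (1 : R)).
Proof.
pose r n : R := (q n)%:R / Num.sqrt (ln n%:R).
have r_ge0 n : 0 <= r n by rewrite divr_ge0 ?sqrtr_ge0.
have r_le e : 0 < e -> \forall n \near \oo, r n <= e.
  move=> e0; have /eqoP/(_ e e0) := q_small.
  apply: filterS => n /=; rewrite normr_nat (ger0_norm (sqrtr_ge0 _)) => qn.
  (* If the square root vanishes, division by zero makes [r n] equal to 0. *)
  have [s0|s0] := eqVneq (Num.sqrt (ln (n%:R : R))) 0.
    by rewrite /r s0 invr0 mulr0 ltW.
  by rewrite /r ler_pdivrMr // lt_neqAle eq_sym s0 sqrtr_ge0.
exists (fun n => 2 * r n); split.
  apply/cvgrPdist_le => e e0; have e2 : 0 < e / 2 by rewrite divr_gt0.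
  apply: filterS (r_le _ e2) => n rn.
  rewrite sub0r normrN ger0_norm ?mulr_ge0 //; lra.
have ln_ge : \forall n \near \oo, 64 <= ln (n%:R : R).
  near=> n; have n64 : expR 64 <= n%:R :> R by near: n; exact: nbhs_infty_ger.
  by rewrite -[leLHS]expRK ler_ln ?posrE ?expR_gt0 // (lt_le_trans (expR_gt0 _) n64).
apply: (@squeeze_cvgr _ _ _ _ (fun n : nat => 1 - n%:R^-1) (fun=> 1)).
- near=> n; rewrite output_prob_le1 andbT; apply: output_prob_ge => //.
    by near: n.
  by near: n; apply: r_le.
- rewrite -[X in _ --> X]subr0; apply: cvgB; first exact: cvg_cst.
  apply/cvgrPdist_le => e e0; near=> n.
  have ne : e^-1 <= n%:R by near: n; exact: nbhs_infty_ger.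
  rewrite sub0r normrN ger0_norm ?invr_ge0 //.
  by rewrite -[leRHS]invrK lef_pV2 ?posrE ?invr_gt0 // (lt_le_trans _ ne) ?invr_gt0.
- exact: cvg_cst.
Unshelve. all: by end_near.
Qed.
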